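(* Let $f,g$ be probability densities on $\mathbb{R}$ with $f,g\in\mathcal{L}$. (a) Suppose that $pf+(1-p)g\in\mathcal{S}$ for some $p\in(0,1)$. Then $f*g(x)\sim f(x)+g(x)$ as $x\to\infty$. If additionally either $pf+(1-p)g\in\mathcal{D}$ for the same $p$, or $$\limsup_{x\to-\infty}\frac{f*g(x)}{f(x)+g(x)}\le C\quad\text{for some constant } C>0,$$ then $f*g\in\mathcal{S}$. (b) Conversely, suppose that $f*g\in\mathcal{S}$ and that either $f*g\in\mathcal{D}$ or $$\liminf_{x\to-\infty}\frac{f*g(x)}{f(x)+g(x)}\ge C\quad\text{for some constant } C>0.$$ Then $f*g(x)\sim f(x)+g(x)$ as $x\to\infty$, and moreover $2^{-1}(f+g)\in\mathcal{S}$.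
   Context: For non-negative functions, $\alpha(x)\sim\beta(x)$ means $\lim_{x\to\infty}\alpha(x)/\beta(x)=1$. For probability densities $f,g$ on $\mathbb{R}$, $f*g(x)=\int_{-\infty}^{\infty}f(x-y)g(y)\,dy$ and $f^{*2}=f*f$. A non-negative measurable function $f$ on $\mathbb{R}$ is long-tailed, $f\in\mathcal{L}$, if $\lim_{x\to\infty}f(x-y)/f(x)=1$ for every $y\in\mathbb{R}$. A probability density $f$ on $\mathbb{R}$ is subexponential, $f\in\mathcal{S}$, if $f\in\mathcal{L}$ and $f^{*2}(x)\sim 2f(x)$ as $x\to\infty$. A function $\alpha:\mathbb{R}\to[0,\infty)$ is almost decreasing, $\alpha\in\mathcal{D}$, if there exist $x_0>0$ and $K>0$ such that $\alpha(x+y)\le K\alpha(x)$ for all $x>x_0$ and $y>0$. *)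

(* Defs.v *)
From HB Require Import structures.
From mathcomp Require Import all_boot all_order all_algebra.
From mathcomp Require Import all_classical all_reals all_analysis.
From mathcomp Require Import measurable_realfun.
Set Implicit Arguments.
Unset Strict Implicit.
Unset Printing Implicit Defensive.
Import Order.TTheory GRing.Theory Num.Theory.
Import numFieldNormedType.Exports.

Local Open Scope classical_set_scope.
Local Open Scope ring_scope.
Local Open Scope ereal_scope.

(* All notions are stated for functions R -> \bar R: the convolution of two
   densities is defined everywhere as a nonnegative integral, but may be +oo on
   a Lebesgue-null set. A real-valued f is used through EFin \o f. *)

Definition prob_density (R : realType) (f : R -> \bar R) : Prop :=
  [/\ measurable_fun [set: R] f, (forall x, 0 <= f x) &
      \int[lebesgue_measure]_(x in [set: R]) f x = 1].

Definition convolution (R : realType) (f g : R -> \bar R) : R -> \bar R :=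
  fun x => \int[lebesgue_measure]_(y in [set: R]) (f (x - y)%R * g y).

(* Division in \bar R satisfies c / 0 = +oo for 0 < c, 0 / 0 = 0 and
   c / +oo = 0 for 0 <= c, including c = +oo. Hence a ratio of nonnegative
   functions that tends to 1 has, eventually, a nonzero finite denominator and
   a nonzero finite numerator. *)
Definition asymp_equiv (R : realType) (a b : R -> \bar R) : Prop :=
  a x / b x @[x --> +oo%R] --> 1.

Definition long_tailed (R : realType) (f : R -> \bar R) : Prop :=
  [/\ measurable_fun [set: R] f, (forall x, 0 <= f x) &
      forall y : R, f (x - y)%R / f x @[x --> +oo%R] --> 1].

Definition subexponential (R : realType) (f : R -> \bar R) : Prop :=
  [/\ prob_density f, long_tailed f &
      asymp_equiv (convolution f f) (fun x => 2%:E * f x)].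

Definition almost_decreasing (R : realType) (a : R -> \bar R) : Prop :=
  (forall x, 0 <= a x) /\
  exists x0 K : R, [/\ (0 < x0)%R, (0 < K)%R &
    forall x y : R, (x0 < x)%R -> (0 < y)%R -> a (x + y)%R <= K%:E * a x].

(* The filter of neighbourhoods of -oo, restricted to the points where the
   ratio a x / b x is not of the undefined form 0 / 0. (If f and g vanish on a
   negative half-line, then so does their convolution.) *)
Definition ninfty_ratio (R : realType) (a b : R -> \bar R) : set_system R :=
  within [set x | ~ (a x = 0 /\ b x = 0)] (ninfty_nbhs R).

(* When the filter contains the empty set, the upper limit is -oo and the lower
   limit is +oo. *)
Definition limsup_ratio_ninfty (R : realType) (a b : R -> \bar R) : \bar R :=
  limf_esup (fun x => a x / b x) (ninfty_ratio a b).

Definition liminf_ratio_ninfty (R : realType) (a b : R -> \bar R) : \bar R :=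
  limf_einf (fun x => a x / b x) (ninfty_ratio a b).

(* Main.v *)
Require Import Defs.
From HB Require Import structures.
From mathcomp Require Import all_boot all_order all_algebra.
From mathcomp Require Import all_classical all_reals all_analysis.
From mathcomp Require Import measurable_realfun.
From mathcomp Require Import ring lra.

(** Write h = f * g. For x > 2A, a convolution a * b (x) splits into the part
    where the second argument y lies in the window [-A, A], the part where
    x - y does, and a remainder where neither does.

    The two window parts are governed by long-tailedness alone. A measurable
    long-tailed function is long-tailed uniformly over shifts in a compact set
    ([long_tailed_uniform]), so for A large the window parts are close to a(x)
    and b(x) ([conv_core_ratio]). Hence a * b >= (1 - e)(a + b) eventually,
    for all long-tailed densities ([conv_ge_sum]), and the whole question is
    whether the remainder is negligible.

    For a subexponential m the equivalence m * m ~ 2m leaves no room for the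
    remainder of m * m, which is therefore at most e m(x) ([subexp_rest]). The
    same bound passes to the remainder of a * b for any densities a and b that
    are O(m) at +oo, provided that the region where one of the arguments y and
    x - y is very negative is under control: either a and b are O(m) at -oo
    also, or m is almost decreasing, in which case the argument that exceeds x
    contributes O(m(x)) and the other one only a tail mass
    ([conv_rest_dominated]). Consequently a long-tailed density with the same
    order as m at +oo is itself subexponential ([subexp_of_dominating]).

    In (a), the mixture m = p f + q g, where q = 1 - p, satisfies
    m * m = p^2 f * f + 2 p q f * g + q^2 g * g ~ 2m.
    Each of the three convolutions is bounded below by [conv_ge_sum], and those
    lower bounds add up to 2m already, so none of them can be exceeded by more
    than o(m); this is h ~ f + g. Now h has the order of m, and the side
    condition is the one required by [subexp_of_dominating] for m and h.

    In (b) the roles are exchanged: f and g are O(h) at +oo by [conv_ge_sum],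
    and the side condition controls the remainder of f * g by h itself, so that
    h <= (1 + e)(f + g) + e h, which gives h ~ f + g. Then
    [subexp_of_dominating] applies to h and (f + g) / 2. *)

Set Implicit Arguments.
Unset Strict Implicit.
Unset Printing Implicit Defensive.
Import Order.TTheory GRing.Theory Num.Theory.
Import numFieldNormedType.Exports.
Local Open Scope classical_set_scope.
Local Open Scope ring_scope.
Local Open Scope ereal_scope.

Local Notation mu := lebesgue_measure.

(** * Reflections and translations of Lebesgue measure *)

Lemma measurable_reflect (R : realType) (x : R) :
  measurable_fun [set: measurableTypeR R]
    (fun y => (x - y)%R : measurableTypeR R).
Proof. exact: measurable_funB. Qed.

Lemma lebesgue_measure_reflect (R : realType) (x : R) (A : set R) :
  measurable A -> mu ((fun y => (x - y)%R) @^-1` A) = mu A.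
Proof.
pose phi : {mfun measurableTypeR R >-> measurableTypeR R} :=
  mfun_Sub (mem_set (@measurable_reflect R x)).
move=> mA; apply/esym.
apply: (@lebesgue_measure_unique R (pushforward mu phi)) => //= _ [[a b]] _ <-.
rewrite /pushforward /=.
rewrite (_ : _ @^-1` _ = `[x - b, x - a[%classic)%R; last first.
  apply/seteqP; split => y /=; rewrite !in_itv/=; lra.
rewrite !lebesgue_measure_itv/= !lte_fin.
rewrite ltrD2l ltrN2; case: ifPn => // _.
by rewrite -!EFinB; congr EFin; ring.
Qed.

Lemma lebesgue_measure_shift (R : realType) (x : R) (A : set R) :
  measurable A -> mu ((fun y => (y + x)%R) @^-1` A) = mu A.
Proof.
move=> mA.
rewrite -[RHS](lebesgue_measure_reflect x)// -[RHS](lebesgue_measure_reflect 0%R).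
  congr (mu _); apply/seteqP; split => y /=.
  by rewrite sub0r opprK addrC.
  by rewrite sub0r opprK addrC.
rewrite -[X in measurable X]setTI; exact: measurable_reflect.
Qed.

Lemma ge0_integral_reflect (R : realType) (x : R) (D : set R) (F : R -> \bar R) :
  measurable D -> measurable_fun D F -> (forall y, 0 <= F y) ->
  \int[mu]_(y in (fun y => (x - y)%R) @^-1` D) F (x - y)%R = \int[mu]_(y in D) F y.
Proof.
move=> mD mF F0.
rewrite -[LHS](@ge0_integral_pushforward _ _ _ _ _ _
  (@measurable_reflect R x) mu D F)//.
apply: eq_measure_integral; first exact: measurable_reflect.
by move=> ? A mA _; exact: lebesgue_measure_reflect.
Qed.

(** * Asymptotic equivalence of extended-real functions *)

(** The bound 1/2 excludes every degenerate ratio: 0 / 0 and u / +oo are 0, at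
    distance 1 from 1, while u / 0 and +oo / v are infinite. *)
Lemma ratio_near1 (R : realType) (u v : \bar R) (d : R) :
  0 <= u -> 0 <= v -> (d <= 2^-1)%R -> u / v \is a fin_num ->
  (`|1 - fine (u / v)| < d)%R ->
  exists r s : R, [/\ u = r%:E, v = s%:E, (0 < s)%R & (`|s - r| < d * s)%R].
Proof.
move=> u0 v0 d2.
have [->|voo] := eqVneq v +oo.
  rewrite invey mule0/= subr0 normr1 => _; lra.
have [->|vn0] := eqVneq v 0.
  rewrite inve0; have [->|un0] := eqVneq u 0.
    rewrite mul0e/= subr0 normr1 => _; lra.
  by rewrite gt0_muley// lt0e un0.
have : 0 < v by rewrite lt0e vn0.
case: v v0 voo vn0 => // s _ _ _; rewrite lte_fin => s0.
case: u u0 => // [r|] _; last first.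
  by rewrite inver gt_eqF// gt0_mulye// lte_fin invr_gt0.
rewrite inver gt_eqF// -EFinM/= => _ rs; exists r, s; split => //.
have -> : (s - r = (1 - r / s) * s)%R by field; lra.
by rewrite normrM (gtr0_norm s0) ltr_pM2r.
Qed.

(** Both bounds are upper bounds, and both values are positive reals: the
    relation is symmetric, and the estimates that use it can be carried out in
    R although convolutions may be infinite. *)
Definition ratio_within (R : realType) (e : R) (u v : \bar R) := exists r s : R,
  [/\ u = r%:E, v = s%:E, (0 < r)%R, (0 < s)%R &
      (r <= (1 + e) * s)%R /\ (s <= (1 + e) * r)%R].

Lemma ratio_withinI (R : realType) (e : R) (u v : \bar R) :
  (0 < e)%R -> 0 <= u -> 0 < v < +oo ->
  u <= (1 + e)%:E * v -> v <= (1 + e)%:E * u -> ratio_within e u v.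
Proof.
move=> e0 + /andP[]; case: v => // s; rewrite lte_fin; case: u => // r.
rewrite lee_fin -!EFinM !lee_fin => r0 s0 _ h1 h2; exists r, s; split => //.
rewrite lt_neqAle r0 andbT; apply/eqP => r00; move: h2; rewrite -r00; lra.
Qed.

Lemma ratio_within_sym (R : realType) (e : R) (u v : \bar R) :
  ratio_within e u v -> ratio_within e v u.
Proof. by move=> [r [s [-> -> r0 s0 [h1 h2]]]]; exists s, r. Qed.

Lemma ratio_within_trans (R : realType) (e : R) (v u w : \bar R) : (0 < e <= 1)%R ->
  ratio_within (e / 3) u v -> ratio_within (e / 3) v w -> ratio_within e u w.
Proof.
move=> /andP[e0 e1] [r [s [-> -> r0 s0 [h1 h2]]]].
move=> [s' [t [[<-] -> _ t0 [h3 h4]]]].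
exists r, t; split => //; split.
  apply: (le_trans h1); apply: (@le_trans _ _ ((1 + e / 3) * ((1 + e / 3) * t))%R).
    by rewrite ler_wpM2l//; lra.
  by rewrite mulrA ler_wpM2r ?(ltW t0) ?(ltW r0)//; nra.
apply: (le_trans h4); apply: (@le_trans _ _ ((1 + e / 3) * ((1 + e / 3) * r))%R).
  by rewrite ler_wpM2l//; lra.
by rewrite mulrA ler_wpM2r ?(ltW t0) ?(ltW r0)//; nra.
Qed.

Lemma ratio_within_le (R : realType) (d e : R) (u v : \bar R) :
  (d <= e)%R -> ratio_within d u v -> ratio_within e u v.
Proof.
move=> de [r [s [-> -> r0 s0 [h1 h2]]]]; exists r, s; split => //; split.
  by apply: (le_trans h1); rewrite ler_wpM2r ?(ltW s0)//; lra.
by apply: (le_trans h2); rewrite ler_wpM2r ?(ltW r0)//; lra.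
Qed.

(** Replaces the limit of an extended-real quotient by inequalities between
    positive reals, the form in which every later estimate is made. *)
Lemma asymp_equivP (R : realType) (a b : R -> \bar R) :
  (forall x, 0 <= a x) -> (forall x, 0 <= b x) ->
  asymp_equiv a b <->
  (forall e, (0 < e)%R -> \forall x \near +oo%R, ratio_within e (a x) (b x)).
Proof.
move=> a0 b0; split.
- move=> /fine_cvgP[fin /cvgrPdist_lt cvg].
  have near_ratio d : (0 < d)%R -> (d <= 2^-1)%R -> \forall x \near +oo%R,
      exists r s : R, [/\ a x = r%:E, b x = s%:E, (0 < s)%R & (`|s - r| < d * s)%R].
    move=> d0 d2; apply: filterS2 fin (cvg d d0) => x.
    exact: ratio_near1.
  move=> e e0; pose d := Num.min 2^-1%R (e / 2)%R.
  have d0 : (0 < d)%R by rewrite lt_min; apply/andP; split; lra.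
  have d2 : (d <= 2^-1)%R by rewrite ge_min lexx.
  have de : (d <= e / 2)%R by rewrite ge_min lexx orbT.
  apply: filterS (near_ratio d d0 d2) => x [r [s [-> -> s0]]].
  rewrite ltr_norml => /andP[h1 h2]; exists r, s.
  (* |s - r| < d s with d <= 1/2 gives r >= s / 2, so e r >= e s / 2 >= d s. *)
  have ds : (d * s <= e / 2 * s)%R by rewrite ler_wpM2r// ltW.
  have ds' : (d * s <= 2^-1 * s)%R by rewrite ler_wpM2r// ltW.
  have er : (e * (s / 2) <= e * r)%R by rewrite ler_wpM2l ?ltW//; lra.
  by split=> //; [lra|split; lra].
- move=> ab; apply/fine_cvgP; split.
    apply: filterS (ab 1%R ltr01) => x [r [s [/= -> -> _ s0 _]]].
    by rewrite inver gt_eqF// -EFinM.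
  apply/cvgrPdist_le => e e0.
  apply: filterS (ab e e0) => x [r [s [/= -> -> _ s0 [h1 h2]]]].
  rewrite inver gt_eqF// -EFinM/=.
  have -> : (1 - r / s = (s - r) / s)%R by field; lra.
  rewrite normrM normfV (gtr0_norm s0) ler_pdivrMr// ler_norml.
  apply/andP; split; first lra.
  by case: (leP r s) => rs; nra.
Qed.

Lemma asymp_equiv_sym (R : realType) (a b : R -> \bar R) :
  (forall x, 0 <= a x) -> (forall x, 0 <= b x) ->
  asymp_equiv a b -> asymp_equiv b a.
Proof.
move=> a0 b0 /asymp_equivP ab; apply/asymp_equivP => // e e0.
by apply: filterS (ab a0 b0 e e0) => x; exact: ratio_within_sym.
Qed.

Lemma asymp_equiv_trans (R : realType) (b a c : R -> \bar R) :
  (forall x, 0 <= a x) -> (forall x, 0 <= b x) -> (forall x, 0 <= c x) ->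
  asymp_equiv a b -> asymp_equiv b c -> asymp_equiv a c.
Proof.
move=> a0 b0 c0 /asymp_equivP ab /asymp_equivP bc; apply/asymp_equivP => // e e0.
pose d := Num.min 1%R e.
have d01 : (0 < d <= 1)%R by rewrite lt_min ltr01 e0 ge_min lexx.
have d30 : (0 < d / 3)%R by lra.
apply: filterS2 (ab a0 b0 _ d30) (bc b0 c0 _ d30) => x ax bx.
apply: (@ratio_within_le _ d); first by rewrite ge_min lexx orbT.
exact: ratio_within_trans ax bx.
Qed.

Lemma near_pinfty_shift (R : realType) (y : R) (P : set R) :
  (\forall x \near +oo%R, P x) -> \forall x \near +oo%R, P (x - y)%R.
Proof.
move=> [M [Mr MP]]; exists (M + y)%R; split; first exact: num_real.
by move=> x Mx; apply: MP; lra.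
Qed.

Lemma long_tailed_asymp (R : realType) (a b : R -> \bar R) :
  measurable_fun [set: R] a -> (forall x, 0 <= a x) ->
  asymp_equiv a b -> long_tailed b -> long_tailed a.
Proof.
move=> ma a0 ab [_ b0 bL]; split => // y.
rewrite -/(asymp_equiv (fun x => a (x - y)%R) a).
apply: (@asymp_equiv_trans _ (fun x => b (x - y)%R)) => //.
  apply/asymp_equivP => // e e0.
  apply: (@near_pinfty_shift _ y (fun x => ratio_within e (a x) (b x))).
  by move/asymp_equivP : ab => /(_ a0 b0 _ e0).
apply: (@asymp_equiv_trans _ b) => //; first exact: bL.
exact: asymp_equiv_sym.
Qed.

(** * Uniformity of long-tailedness on compact sets *)

(** Otherwise mu (D `&` P (u n)) <= c along some sequence u n --> +oo. The
    sets of the t in D that lie in P (u m) for all m >= n increase to D, by the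
    pointwise hypothesis, and have measure at most c, so mu D <= c. *)
Lemma eventually_large_measure (R : realType) (D : set R) (P : R -> set R) (c : R) :
  measurable D -> (forall x, measurable (D `&` P x)) ->
  (forall t, \forall x \near +oo%R, P x t) ->
  c%:E < mu D -> \forall x \near +oo%R, c%:E < mu (D `&` P x).
Proof.
move=> mD mP Pnear cD; apply: contrapT => notP.
have bad (n : nat) : exists x : R, (n%:R < x)%R /\ mu (D `&` P x) <= c%:E.
  apply: contrapT => nbad; apply: notP; exists n%:R; split; first exact: num_real.
  move=> x nx; rewrite ltNge; apply/negP => cx; apply: nbad; by exists x.
move/choice : bad => [u uP].
pose G n := \bigcap_(m in [set m | (n <= m)%N]) (D `&` P (u m)).
have mG n : measurable (G n) by apply: bigcap_measurable => //; exists n => /=.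
have GD : \bigcup_n G n = D.
  apply/seteqP; split => [t [n _ /(_ n (leqnn n))[]]//|t Dt].
  have [M [_ MP]] := Pnear t.
  have [n Mn] : exists n : nat, (M < n%:R)%R.
    by exists (Num.trunc `|M|).+1; rewrite (le_lt_trans (ler_norm _))// truncnS_gt.
  exists n => // m /= nm; split => //; apply: MP.
  by rewrite (lt_trans Mn)// (le_lt_trans _ (uP m).1)// ler_nat.
have Gcvg : mu \o G @ \oo --> mu D.
  rewrite -[X in _ --> mu X]GD; apply: nondecreasing_cvg_mu => //.
    by rewrite GD.
  move=> n m nm; apply/subsetPset => t Gt k /= mk; apply: Gt => /=.
  exact: leq_trans mk.
have : mu D <= c%:E.
  apply: (cvge_le _ Gcvg); apply: nearW => n /=.
  apply: le_trans (uP n).2; apply: le_measure; rewrite ?inE; [exact: mG|exact: mP|].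
  by move=> t Gt; exact: (Gt n (leqnn n)).
by rewrite leNgt cD.
Qed.

(** Stated with inequalities, and not with [ratio_within], so that its
    measurability is immediate; the two agree when a x is positive and finite. *)
Definition comparable_shifts (R : realType) (a : R -> \bar R) (d x : R) : set R :=
  [set t | a (x + t)%R <= (1 + d)%:E * a x /\ a x <= (1 + d)%:E * a (x + t)%R].

Lemma measurable_comparable_shifts (R : realType) (a : R -> \bar R) (d x : R) :
  measurable_fun [set: R] a -> measurable (comparable_shifts a d x).
Proof.
move=> ma.
have max : measurable_fun [set: R] (fun t => a (x + t)%R).
  by apply: (measurableT_comp ma); exact: measurable_funD.
apply: measurableI.
  rewrite -[X in measurable X]setTI; apply: measurable_lee => //.
rewrite -[X in measurable X]setTI; apply: measurable_lee => //.
by apply: measurable_funeM.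
Qed.

(** The uniform convergence theorem for slowly varying functions, in additive
    form, by the argument of Csiszar and Erdos. For x large, the good shifts of
    x fill more than 3A out of the length 4A of [-2A, 2A], and so do those of
    x - y. After translation by y both sets lie in [-3A, 3A], of length 6A, so
    they meet: a(x) and a(x - y) are both close to some a(x + t). *)
Lemma long_tailed_uniform (R : realType) (a : R -> \bar R) (A e : R) :
  long_tailed a -> (0 < A)%R -> (0 < e)%R ->
  \forall x \near +oo%R, forall y, (`|y| <= A)%R ->
    ratio_within e (a (x - y)%R) (a x).
Proof.
move=> [ma a0 aL] A0 e0.
pose d := Num.min 1%R e.
have d01 : (0 < d <= 1)%R by rewrite lt_min ltr01 e0 ge_min lexx.
have d30 : (0 < d / 3)%R by lra.
have aLd y : \forall x \near +oo%R, ratio_within (d / 3) (a (x - y)%R) (a x).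
  by have /asymp_equivP : asymp_equiv (fun x => a (x - y)%R) a := aL y; exact.
pose V := comparable_shifts a (d / 3).
pose D : set R := `[(- (2 * A))%R, (2 * A)%R]%classic.
have mV x : measurable (V x) by exact: measurable_comparable_shifts.
have mD : measurable D by exact: measurable_itv.
have mDV z : measurable (D `&` V z) by exact: (measurableI _ _ mD (mV z)).
have muD : mu D = (4 * A)%:E.
  rewrite lebesgue_measure_itv/= lte_fin ifT; last lra.
  by rewrite -EFinB; congr EFin; ring.
have [M [_ MV]] : \forall x \near +oo%R, (3 * A)%:E < mu (D `&` V x).
  apply: eventually_large_measure => //.
  - move=> t; apply: filterS (aLd (- t)%R) => x [r [s []]].
    rewrite opprK => ar as_ _ _ [h1 h2].
    by rewrite /V/comparable_shifts/= ar as_ -!EFinM !lee_fin.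
  - by rewrite muD lte_fin; lra.
have [N [_ NV]] : \forall x \near +oo%R, 0 < a x < +oo.
  apply: filterS (aLd 0%R) => x [r [s [_ -> _ s0 _]]].
  by rewrite lte_fin s0 ltry.
exists (Num.max M N + A)%R; split; first exact: num_real.
move=> x Mx y; rewrite ler_norml => /andP[y1 y2].
have [leM leN] : (M <= Num.max M N)%R /\ (N <= Num.max M N)%R.
  by rewrite !le_max !lexx orbT.
have mS2 : measurable ((fun s => (s + y)%R) @^-1` (D `&` V (x - y)%R)).
  rewrite -[X in measurable X]setTI.
  by apply: (measurable_funD (@measurable_id _ _ _) (measurable_cst y)).
have [t [[_ [Vt1 Vt2]] [_ [Wt1 Wt2]]]] : (D `&` V x) `&`
    ((fun s => (s + y)%R) @^-1` (D `&` V (x - y)%R)) !=set0.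
  apply/set0P/negP => /eqP disj.
  have : mu ((D `&` V x) `|` ((fun s => (s + y)%R) @^-1` (D `&` V (x - y)%R)))
      <= (6 * A)%:E.
    have <- : mu (`[- (3 * A), 3 * A]%classic%R : set R) = (6 * A)%:E.
      rewrite lebesgue_measure_itv/= lte_fin ifT; last lra.
      by rewrite -EFinB; congr EFin; ring.
    apply: le_measure; rewrite ?inE.
    - by apply: measurableU; [exact: mDV|exact: mS2].
    - exact: measurable_itv.
    - by move=> s [|] []; rewrite /D /= !in_itv/= => + _; lra.
  have -> : mu ((D `&` V x) `|` ((fun s => (s + y)%R) @^-1` (D `&` V (x - y)%R)))
      = mu (D `&` V x) + mu (D `&` V (x - y)%R).
    rewrite -[in RHS](lebesgue_measure_shift y (mDV (x - y)%R)).
    by apply: measureU => //; exact: mDV.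
  apply/negP; rewrite -ltNge (_ : (6 * A)%:E = (3 * A)%:E + (3 * A)%:E).
    by apply: lteD; apply: MV; lra.
  by rewrite -EFinD; congr EFin; ring.
move: Wt1 Wt2; rewrite (_ : x - y + (t + y) = x + t)%R; last ring.
move=> Wt1 Wt2; apply: (@ratio_within_le _ d); first by rewrite ge_min lexx orbT.
apply: (@ratio_within_trans _ _ (a (x + t)%R)) => //.
  by apply/ratio_within_sym/ratio_withinI => //; apply: NV; lra.
by apply: ratio_withinI => //; apply: NV; lra.
Qed.

(** * Splitting a convolution *)

Lemma measurable_conv_integrand (R : realType) (a b : R -> \bar R) (x : R) :
  measurable_fun [set: R] a -> measurable_fun [set: R] b ->
  measurable_fun [set: R] (fun y => a (x - y)%R * b y).
Proof.
move=> ma mb; apply: emeasurable_funM => //.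
by apply: (measurableT_comp ma); exact: measurable_funB.
Qed.

Lemma convolution_density (R : realType) (a b : R -> \bar R) :
  prob_density a -> prob_density b -> prob_density (convolution a b).
Proof.
move=> [ma a0 a1] [mb b0 b1].
pose F (z : measurableTypeR R * measurableTypeR R) := a (z.1 - z.2)%R * b z.2.
have mF : measurable_fun setT F.
  apply: emeasurable_funM; last exact: (measurableT_comp mb).
  by apply: (measurableT_comp ma); exact: measurable_funB.
have F0 z : 0 <= F z by rewrite mule_ge0.
split.
- exact: (measurable_fun_fubini_tonelli_F (m2 := mu) F mF F0).
- by move=> x; apply: integral_ge0 => y _; rewrite mule_ge0.
have -> : \int[mu]_(x in [set: R]) convolution a b x =
    \int[mu]_y \int[mu]_x F (x, y).
  exact: (fubini_tonelli (m1 := mu) (m2 := mu) F mF F0).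
rewrite -b1; apply: eq_integral => y _.
rewrite /F/= ge0_integralZr//; last first.
  by apply: (measurableT_comp ma); exact: measurable_funB.
rewrite (_ : \int[mu]_x a (x - y)%R = 1) ?mul1e//.
rewrite -[RHS]a1 -[RHS](@ge0_integral_reflect _ 0%R setT)// preimage_setT.
rewrite -[LHS](@ge0_integral_reflect _ y setT)//; last first.
  by apply: (measurableT_comp ma); exact: measurable_funB.
by rewrite preimage_setT; apply: eq_integral => z _; congr a; ring.
Qed.

Definition window (R : realType) (A : R) : set R := `[(- A)%R, A]%classic.

(** The part of a * b (x) that reproduces a(x): the mass of b sits near 0. *)
Definition conv_core (R : realType) (a b : R -> \bar R) (A x : R) : \bar R :=
  \int[mu]_(y in window A) (a (x - y)%R * b y).

Definition far_set (R : realType) (A x : R) : set R :=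
  ~` window A `&` (fun y => (x - y)%R) @^-1` (~` window A).

Definition conv_rest (R : realType) (a b : R -> \bar R) (A x : R) : \bar R :=
  \int[mu]_(y in far_set A x) (a (x - y)%R * b y).

Lemma measurable_window (R : realType) (A : R) : measurable (window A).
Proof. exact: measurable_itv. Qed.

Lemma measurable_preimage_reflect (R : realType) (x : R) (D : set R) :
  measurable D -> measurable ((fun y => (x - y)%R) @^-1` D).
Proof.
by move=> mD; rewrite -[X in measurable X]setTI; exact: measurable_reflect.
Qed.

Lemma measurable_far_set (R : realType) (A x : R) : measurable (far_set A x).
Proof.
have mWC : measurable (~` window A) by apply: measurableC; exact: measurable_window.
by apply: measurableI => //; exact: measurable_preimage_reflect.
Qed.

(** For x > 2A the windows |y| <= A and |x - y| <= A are disjoint; the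
    reflection y |-> x - y turns the integral over the second one into a core
    with a and b exchanged. *)
Lemma conv_split (R : realType) (a b : R -> \bar R) (A x : R) :
  measurable_fun [set: R] a -> (forall z, 0 <= a z) ->
  measurable_fun [set: R] b -> (forall z, 0 <= b z) ->
  (2 * A < x)%R ->
  convolution a b x = conv_core a b A x + conv_core b a A x + conv_rest a b A x.
Proof.
move=> ma a0 mb b0 Ax.
pose W' := (fun y => (x - y)%R) @^-1` window A.
have mW' : measurable W' by apply: measurable_preimage_reflect; exact: measurable_window.
have mI := measurable_conv_integrand x ma mb.
have I0 y : 0 <= a (x - y)%R * b y by rewrite mule_ge0.
have <- : \int[mu]_(y in W') (a (x - y)%R * b y) = conv_core b a A x.
  rewrite /conv_core -[RHS](@ge0_integral_reflect _ x).
  - by apply: eq_integral => y _; rewrite muleC; congr (b _ * _); ring.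
  - exact: measurable_window.
  - by apply: measurable_funTS; exact: measurable_conv_integrand.
  - by move=> y; rewrite mule_ge0.
have mW := @measurable_window R A; have mF := @measurable_far_set R A x.
rewrite -addeA -ge0_integral_setU//; first last.
- by rewrite disj_set2E; apply/eqP/seteqP; split => // y [Wy []].
- exact: measurable_funTS.
rewrite -ge0_integral_setU//; first last.
- rewrite disj_set2E; apply/eqP/seteqP; split => // y [Wy [|[]//]].
  by move: Wy; rewrite /W'/window/= !in_itv/= => /andP[? ?] /andP[? ?]; lra.
- exact: measurable_funTS.
- exact: measurableU.
congr (integral _ _ _); apply/seteqP; split => // y _.
have [Wy|nWy] := pselect (window A y); first by left.
by right; have [W'y|nW'y] := pselect (W' y); [left|right].
Qed.

Lemma density_tail (R : realType) (b : R -> \bar R) (e : R) :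
  prob_density b -> (0 < e)%R ->
  exists2 A0 : R, (0 < A0)%R & forall A, (A0 <= A)%R ->
    (1 - e)%:E <= \int[mu]_(y in window A) b y /\
    \int[mu]_(y in ~` window A) b y <= e%:E.
Proof.
move=> [mb b0 b1] e0.
have cvg : \int[mu]_(y in window (n%:R : R)) b y @[n --> \oo] --> 1.
  rewrite -b1 (_ : [set: R] = \bigcup_n window (n%:R : R)).
    apply: ge0_nondecreasing_set_cvg_integral => //.
    + move=> n m nm; apply/subsetPset => y; rewrite /window/= !in_itv/= => /andP[y1 y2].
      have : (n%:R <= m%:R :> R)%R by rewrite ler_nat.
      by move=> ?; apply/andP; split; lra.
    + by move=> n; exact: measurable_window.
    + by move=> n; exact: measurable_funTS.
  apply/esym/seteqP; split => // y _; exists (Num.trunc `|y|).+1 => //.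
  by rewrite /window/= in_itv/= -ler_norml ltW// truncnS_gt.
have [N _ NP] : \forall n \near \oo, (1 - e)%:E < \int[mu]_(y in window (n%:R : R)) b y.
  have lt1 : (1 - e < 1)%R by lra.
  exact: (cvg _ (@nbhs_open_ereal_gt _ 1%R (fun r => r - e)%R lt1)).
exists N.+1%:R => [|A NA]; first by rewrite ltr0n.
have mW := @measurable_window R A.
have low : (1 - e)%:E <= \int[mu]_(y in window A) b y.
  apply: (le_trans (ltW (NP N.+1 (leqnSn N)))).
  apply: ge0_subset_integral => //; [exact: measurable_window|exact: measurable_funTS|].
  move=> y; rewrite /window/= !in_itv/= => /andP[y1 y2]; apply/andP; split; lra.
split => //.
have : \int[mu]_(y in window A) b y + \int[mu]_(y in ~` window A) b y = 1.
  rewrite -ge0_integral_setU ?setUv//; first exact: measurableC.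
  by rewrite disj_set2E setICr.
have : 0 <= \int[mu]_(y in ~` window A) b y by exact: integral_ge0.
move: low; set u := integral _ _ _; set v := integral _ _ _.
case: u => [u| |]; case: v => [v| |]//.
by rewrite -EFinD !lee_fin => h1 h2 [h3]; lra.
Qed.

Lemma density_integral_le1 (R : realType) (b : R -> \bar R) (D : set R) :
  prob_density b -> measurable D -> \int[mu]_(y in D) b y <= 1.
Proof.
by move=> [mb b0 <-] mD; exact: ge0_subset_integral.
Qed.

(** On the window a(x - y) is uniformly close to a(x), so the core is close to
    a(x) times the mass of b on the window, which is close to 1. *)
Lemma conv_core_ratio (R : realType) (a b : R -> \bar R) (e : R) :
  long_tailed a -> prob_density b -> (0 < e)%R ->
  exists2 A0 : R, (0 < A0)%R & forall A, (A0 <= A)%R ->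
    \forall x \near +oo%R, ratio_within e (conv_core a b A x) (a x).
Proof.
move=> aL bP e0; pose d := Num.min 2^-1%R (e / 4)%R.
have [d0 [d2 de]] : (0 < d)%R /\ (d <= 2^-1)%R /\ (d <= e / 4)%R.
  by rewrite lt_min !ge_min !lexx orbT; split => //; apply/andP; split; lra.
have [A0 A00 A0P] := density_tail bP d0.
exists A0 => // A /[dup] AA0 /A0P[low _].
have A_gt0 : (0 < A)%R by lra.
have up := density_integral_le1 bP (@measurable_window R A).
have [ma a0 _] := aL; have [mb b0 _] := bP.
apply: filterS (long_tailed_uniform aL A_gt0 d0) => x xP.
have [|_ [r [_ ar _ r0 _]]] := xP 0%R; first by rewrite normr0 ltW.
have mI := measurable_conv_integrand x ma mb.
have mW := @measurable_window R A.
apply: ratio_withinI => //.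
- by apply: integral_ge0 => y _; rewrite mule_ge0.
- by rewrite ar lte_fin r0 ltry.
- apply: (@le_trans _ _ (\int[mu]_(y in window A) ((1 + d)%:E * a x * b y))).
    apply: ge0_le_integral => //.
    + by move=> y _; rewrite mule_ge0.
    + exact: measurable_funTS.
    + by apply: measurable_funTS; apply: emeasurable_funM.
    + move=> y; rewrite /window/= in_itv/= -ler_norml => /xP[s [t [-> -> _ _ [+ _]]]].
      by move=> st; apply: lee_wpmul2r; rewrite ?b0// -EFinM lee_fin.
  rewrite ge0_integralZl//; last 2 first.
    exact: measurable_funTS.
    by rewrite mule_ge0// lee_fin; lra.
  rewrite ar -EFinM -[leRHS]mule1.
  rewrite (@le_trans _ _ (((1 + d) * r)%:E * 1))//.
    by apply: lee_wpmul2l => //; rewrite lee_fin mulr_ge0// ?ltW//; lra.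
  by rewrite !mule1 -EFinM lee_fin ler_wpM2r// ?(ltW r0)//; lra.
- have : (1 - d)%:E * a x <= (1 + d)%:E * conv_core a b A x.
    apply: (@le_trans _ _ (\int[mu]_(y in window A) (a x * b y))).
      rewrite ge0_integralZl//; last exact: measurable_funTS.
      by rewrite muleC; apply: lee_wpmul2l.
    rewrite -ge0_integralZl//; first last.
    + by rewrite lee_fin; lra.
    + by move=> y _; rewrite mule_ge0.
    + exact: measurable_funTS.
    apply: ge0_le_integral => //.
    + by move=> y _; rewrite mule_ge0.
    + by apply: measurable_funTS; apply: emeasurable_funM.
    + by apply: measurable_funTS; apply: emeasurable_funM.
    + move=> y; rewrite /window/= in_itv/= -ler_norml => /xP[s [t [-> -> _ _ [_ +]]]].
      by move=> st; rewrite muleA; apply: lee_wpmul2r; rewrite ?b0// -EFinM lee_fin.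
  have : 0 <= conv_core a b A x.
    by apply: integral_ge0 => y _; rewrite mule_ge0.
  rewrite ar; case: (conv_core a b A x) => [u| |]// u0.
    rewrite -!EFinM !lee_fin in u0 * => ru.
    have r3u : (r <= 3 * u)%R by nra.
    have : (d * r <= d * (3 * u))%R by rewrite ler_wpM2l// ltW.
    have : (d * u <= e / 4 * u)%R by rewrite ler_wpM2r.
    lra.
  by move=> _; rewrite gt0_muley ?leey// lte_fin; lra.
Qed.

(** * Two-sided bounds for convolutions *)

(** The two cores already account for a + b. *)
Lemma conv_ge_sum (R : realType) (a b : R -> \bar R) (e : R) :
  prob_density a -> long_tailed a -> prob_density b -> long_tailed b ->
  (0 < e)%R ->
  \forall x \near +oo%R, a x + b x <= (1 + e)%:E * convolution a b x.
Proof.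
move=> aP aL bP bL e0.
have [ma a0 _] := aP; have [mb b0 _] := bP.
have [A A0 AP] := conv_core_ratio aL bP e0.
have [B B0 BP] := conv_core_ratio bL aP e0.
pose C := Num.max A B.
have [AC BC] : (A <= C /\ B <= C)%R by rewrite !le_max !lexx orbT.
have nearC : \forall x \near +oo%R, (2 * C < x)%R.
  by exists (2 * C)%R; split=> //; exact: num_real.
apply: filterS3 nearC (AP C AC) (BP C BC) => x xC.
move=> [u [r [ue re _ _ [_ h1]]]] [v [s [ve se _ _ [_ h2]]]].
rewrite (@conv_split _ a b C x)// ue ve re se -EFinD.
have : 0 <= conv_rest a b C x.
  by apply: integral_ge0 => y _; rewrite mule_ge0.
case: (conv_rest a b C x) => [w| |]//.
  by rewrite -EFinD -EFinM !lee_fin; nra.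
by rewrite addey// gt0_muley ?leey// lte_fin; lra.
Qed.

(** Each core of m * m is at least about m(x), and their sum with the rest is
    at most about 2 m(x). *)
Lemma subexp_rest (R : realType) (m : R -> \bar R) (e : R) :
  subexponential m -> (0 < e)%R ->
  exists2 A0 : R, (0 < A0)%R & forall A, (A0 <= A)%R ->
    \forall x \near +oo%R, conv_rest m m A x <= e%:E * m x.
Proof.
move=> [mP mL mE] e0; have [mm m0 _] := mP.
pose d := (e / 4)%R; have d0 : (0 < d)%R by rewrite /d; lra.
have [A0 A00 A0P] := conv_core_ratio mL mP d0.
exists A0 => // A AA0.
have nearA : \forall x \near +oo%R, (2 * A < x)%R.
  by exists (2 * A)%R; split=> //; exact: num_real.
have conv0 x : 0 <= convolution m m x.
  by have [_ +] := convolution_density mP mP; exact.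
have m20 x : 0 <= 2%:E * m x by rewrite mule_ge0.
have convm := (asymp_equivP conv0 m20).1 mE d d0.
apply: filterS3 nearA (A0P A AA0) convm => x xA.
move=> [u [r [ue re u0 r0 [h1 h2]]]] [v [s [ve se _ _ [h3 h4]]]].
have : 0 <= conv_rest m m A x.
  by apply: integral_ge0 => y _; rewrite mule_ge0.
move: ve se; rewrite (@conv_split _ m m A x)// ue re -EFinM.
case: (conv_rest m m A x) => [w| |]//.
rewrite -!EFinD -EFinM => -[vE] [sE]; rewrite !lee_fin => w0.
rewrite -vE -sE in h3.
have du : (u * d + u >= r)%R by lra.
have ur : (u <= r + r * d)%R by lra.
have -> : (e = 4 * d)%R by rewrite /d; field.
have [r_le_u|u_lt_r] := leP r u; first by lra.
have : (u * d <= r * d)%R by rewrite ler_wpM2r// ltW.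
lra.
Qed.

(** The points excluded from the filter of the upper limit are those where a
    and b both vanish, and there the inequality is trivial. *)
Lemma limsup_ratio_ninfty_le (R : realType) (a b : R -> \bar R) (C : R) :
  (forall x, 0 <= a x) -> (forall x, 0 <= b x) -> (0 < C)%R ->
  limsup_ratio_ninfty a b <= C%:E ->
  \forall x \near -oo%R, a x <= (C + 1)%:E * b x.
Proof.
move=> a0 b0 C0 abC.
have : limsup_ratio_ninfty a b < (C + 1)%:E.
  by apply: (le_lt_trans abC); rewrite lte_fin; lra.
rewrite /limsup_ratio_ninfty limf_esupE => /ereal_inf_lt[_ [A [M [Mr MA]] <-] supA].
exists M; split=> // x xM.
have [[-> ->]|nab] := pselect (a x = 0 /\ b x = 0); first by rewrite mule0.
have : a x / b x <= (C + 1)%:E.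
  by apply: le_trans (ltW supA); apply: ereal_sup_ubound; exists x => //; exact: MA.
have := a0 x; have := b0 x; move: nab.
case: (b x) => [s| |]//; last by rewrite gt0_muley ?leey// lte_fin; lra.
have [->|s0] := eqVneq s 0%R.
  rewrite inver eqxx => nab _ ax0; rewrite gt0_muley// lt0e ax0 andbT.
  by apply/eqP => ax; apply: nab.
rewrite lee_fin => _ s_ge0; have s_gt0 : (0 < s)%R by rewrite lt0r s0.
rewrite inver (negbTE s0); case: (a x) => [r| |]// r0.
  by rewrite -!EFinM !lee_fin ler_pdivrMr.
by rewrite gt0_mulye// lte_fin invr_gt0.
Qed.

Lemma liminf_ratio_ninfty_ge (R : realType) (a b : R -> \bar R) (C : R) :
  (forall x, 0 <= a x) -> (forall x, 0 <= b x) -> (0 < C)%R ->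
  C%:E <= liminf_ratio_ninfty a b ->
  \forall x \near -oo%R, (C / 2)%:E * b x <= a x.
Proof.
move=> a0 b0 C0 abC.
have C2 : (0 < C / 2)%R by lra.
have : (C / 2)%:E < liminf_ratio_ninfty a b.
  by apply: (lt_le_trans _ abC); rewrite lte_fin; lra.
rewrite /liminf_ratio_ninfty limf_einfE => /ereal_sup_gt[_ [A [M [Mr MA]] <-] infA].
exists M; split=> // x xM.
have [[-> ->]|nab] := pselect (a x = 0 /\ b x = 0); first by rewrite mule0.
have : (C / 2)%:E <= a x / b x.
  by apply: (le_trans (ltW infA)); apply: ereal_inf_lbound; exists x => //; exact: MA.
have := a0 x; have := b0 x.
case: (b x) => [s| |]//; last first.
  by rewrite invey mule0 lee_fin => _ _ ?; exfalso; lra.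
have [->|s0] := eqVneq s 0%R; first by rewrite mule0.
rewrite lee_fin => s_ge0; have s_gt0 : (0 < s)%R by rewrite lt0r s0.
rewrite inver (negbTE s0); case: (a x) => [r| |]// r0; last by rewrite leey.
by rewrite -!EFinM !lee_fin ler_pdivlMr.
Qed.

Lemma far_set_cases (R : realType) (A x y : R) :
  (0 < A)%R -> (2 * A < x)%R -> far_set A x y ->
  [\/ (A < y)%R /\ (A < x - y)%R, (y < - A)%R | (x - y < - A)%R].
Proof.
rewrite /far_set/window/= !in_itv/= => A0 xA -[/negP + /negP].
rewrite !negb_and -!ltNge => /orP[h1|h1] /orP[h2|h2].
- by exfalso; lra.
- by constructor 2.
- by constructor 3.
- by constructor 1.
Qed.

(** On the remainder region the integrand is bounded pointwise by a multiple of
    m(x - y) m(y) + m(x) b(y) + m(x) a(x - y). The first term comes from the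
    arguments where a and b are both O(m), and integrates to the remainder of
    m * m. The other two occur when m is almost decreasing and one of y and
    x - y is below -A: the other one then exceeds x, so that its density is
    O(m(x)), and what is left is the mass of a density off the window. *)
Lemma conv_rest_dominated (R : realType) (a b m : R -> \bar R) (C e : R) :
  subexponential m -> prob_density a -> prob_density b -> (0 < C)%R ->
  (\forall x \near +oo%R, a x <= C%:E * m x /\ b x <= C%:E * m x) ->
  almost_decreasing m \/
    (\forall x \near -oo%R, a x <= C%:E * m x /\ b x <= C%:E * m x) ->
  (0 < e)%R ->
  exists2 A0 : R, (0 < A0)%R & forall A, (A0 <= A)%R ->
    \forall x \near +oo%R, conv_rest a b A x <= e%:E * m x.
Proof.
move=> mS aP bP C0 domR domL e0.
have [[mm m0 _] _ _] := mS; have [ma a0 _] := aP; have [mb b0 _] := bP.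
have [L [B [L0 B0 dom]]] : exists L B : R, [/\ (0 < L)%R, (0 < B)%R &
    forall A x y, (B <= A)%R -> (2 * A < x)%R -> far_set A x y ->
      a (x - y)%R * b y <=
      L%:E * (m (x - y)%R * m y + (m x * b y + m x * a (x - y)%R))].
  have prod_le (c c' : R) u v p q : (0 <= c)%R -> (0 <= c')%R ->
      0 <= u -> 0 <= v -> 0 <= p -> 0 <= q ->
      u <= c%:E * p -> v <= c'%:E * q -> u * v <= (c * c')%:E * (p * q).
    move=> c0 c'0 u0 v0 p0 q0 up vq; rewrite EFinM muleACA.
    exact: lee_pmul.
  move: domR => [M [_ MP]].
  case: domL => [[_ [x0 [K [x00 K0 mK]]]]|[N [_ NP]]].
  - exists (C * C + C * K)%R, (Num.max x0 M).
    have LCC : (C * C <= C * C + C * K)%R by rewrite lerDl mulr_ge0// ltW.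
    have LCK : (C * K <= C * C + C * K)%R by rewrite lerDr mulr_ge0// ltW.
    have L0 : (0 < C * C + C * K)%R by rewrite addr_gt0// mulr_gt0.
    have [Bx0 BM] : (x0 <= Num.max x0 M /\ M <= Num.max x0 M)%R.
      by rewrite !le_max !lexx orbT.
    split => //; first exact: lt_le_trans Bx0.
    have mCK z w : (Num.max x0 M < z)%R -> (z < w)%R -> C%:E * m w <= (C * K)%:E * m z.
      move=> Bz zw; rewrite EFinM -muleA; apply: lee_wpmul2l.
        by rewrite lee_fin ltW.
      by rewrite (_ : w = z + (w - z))%R; [apply: mK; lra|ring].
    have le_L c u v : (c <= C * C + C * K)%R -> 0 <= u -> u <= v ->
        c%:E * u <= (C * C + C * K)%:E * v.
      move=> cL u0 uv; apply: (@le_trans _ _ ((C * C + C * K)%:E * u)).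
        by apply: lee_wpmul2r; rewrite ?lee_fin.
      by apply: lee_wpmul2l; rewrite // lee_fin ltW.
    move=> A x y BA xA Fxy.
    have A0 : (0 < A)%R by lra.
    have [[yA xyA]|yA|yA] := far_set_cases A0 xA Fxy.
    + have [axy _] := MP (x - y)%R ltac:(lra).
      have [_ by_] := MP y ltac:(lra).
      apply: (@le_trans _ _ ((C * C)%:E * (m (x - y)%R * m y))).
        by apply: prod_le => //; exact: ltW.
      by apply: le_L; rewrite ?mule_ge0// leeDl// adde_ge0// mule_ge0.
    + have [axy _] := MP (x - y)%R ltac:(lra).
      have := le_trans axy (mCK x (x - y)%R ltac:(lra) ltac:(lra)).
      move=> /(lee_wpmul2r (b0 y)) /le_trans; apply.
      rewrite -muleA; apply: le_L => //; first by rewrite mule_ge0.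
      by rewrite addeCA leeDl// adde_ge0// mule_ge0.
    + have [_ by_] := MP y ltac:(lra).
      have := le_trans by_ (mCK x y ltac:(lra) ltac:(lra)).
      move=> /(lee_wpmul2l (a0 (x - y)%R)) /le_trans; apply.
      rewrite muleC -muleA; apply: le_L => //; first by rewrite mule_ge0.
      by rewrite addeA leeDr// adde_ge0// mule_ge0.
  - pose B := Num.max 1%R (Num.max M (- N))%R.
    have [B1 BM BN] : [/\ 1 <= B, M <= B & - N <= B]%R.
      by rewrite /B !le_max !lexx !orbT.
    have outside A z : (B <= A)%R -> (A < z)%R \/ (z < - A)%R ->
        a z <= C%:E * m z /\ b z <= C%:E * m z.
      by move=> BA [Az|zA]; [apply: MP|apply: NP]; lra.
    exists (C * C)%R, B; split; [by rewrite mulr_gt0|lra|].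
    move=> A x y BA xA Fxy.
    have [axy by_] : a (x - y)%R <= C%:E * m (x - y)%R /\ b y <= C%:E * m y.
      have A0 : (0 < A)%R by lra.
      have [[yA xyA]|yA|yA] := far_set_cases A0 xA Fxy.
      + by split; [case: (outside A (x - y)%R BA)|case: (outside A y BA)]; auto.
      + by split; [case: (outside A (x - y)%R BA)|case: (outside A y BA)];
          auto; left; lra.
      + by split; [case: (outside A (x - y)%R BA)|case: (outside A y BA)];
          auto; left; lra.
    apply: (@le_trans _ _ ((C * C)%:E * (m (x - y)%R * m y))).
      by apply: prod_le => //; exact: ltW.
    apply: lee_wpmul2l; first by rewrite lee_fin mulr_ge0// ltW.
    by rewrite leeDl// adde_ge0// mule_ge0.
pose d := (e / (3 * L))%R.
have d0 : (0 < d)%R by rewrite divr_gt0// mulr_gt0.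
have [A1 A10 A1P] := subexp_rest mS d0.
have [A2 A20 A2P] := density_tail aP d0.
have [A3 A30 A3P] := density_tail bP d0.
pose A0 := Num.max (Num.max B A1) (Num.max A2 A3).
have [BA0 A1A0 A2A0 A3A0] : [/\ B <= A0, A1 <= A0, A2 <= A0 & A3 <= A0]%R.
  by rewrite /A0 !le_max !lexx !orbT.
exists A0 => [|A AA0]; first exact: lt_le_trans BA0.
have nearA : \forall x \near +oo%R, (2 * A < x)%R.
  by exists (2 * A)%R; split=> //; exact: num_real.
apply: filterS2 nearA (A1P A (le_trans A1A0 AA0)) => x xA restm.
have [_ tail_a] := A2P A (le_trans A2A0 AA0).
have [_ tail_b] := A3P A (le_trans A3A0 AA0).
have mF := @measurable_far_set R A x.
have mW : measurable (~` window A : set R).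
  by apply: measurableC; exact: measurable_window.
have mI := measurable_conv_integrand x ma mb.
have mIm := measurable_conv_integrand x mm mm.
have mar : measurable_fun [set: R] (fun y => a (x - y)%R).
  by apply: (measurableT_comp ma); exact: measurable_funB.
have mbx : measurable_fun [set: R] (fun y => m x * b y) by apply: emeasurable_funM.
have max : measurable_fun [set: R] (fun y => m x * a (x - y)%R).
  by apply: emeasurable_funM.
apply: (@le_trans _ _ (\int[mu]_(y in far_set A x)
    (L%:E * (m (x - y)%R * m y + (m x * b y + m x * a (x - y)%R))))).
  apply: ge0_le_integral => //.
  - by move=> y _; rewrite mule_ge0.
  - exact: measurable_funTS.
  - apply: measurable_funTS; apply: measurable_funeM.
    by apply: emeasurable_funD => //; exact: emeasurable_funD.
  - by move=> y; apply: dom => //; exact: le_trans AA0.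
rewrite ge0_integralZl//; last 3 first.
- apply: measurable_funTS.
  by apply: emeasurable_funD => //; exact: emeasurable_funD.
- by move=> y _; rewrite !adde_ge0// mule_ge0.
- by rewrite lee_fin ltW.
rewrite ge0_integralD//; last 4 first.
- by move=> y _; rewrite mule_ge0.
- exact: measurable_funTS.
- by move=> y _; rewrite adde_ge0// mule_ge0.
- by apply: measurable_funTS; exact: emeasurable_funD.
rewrite ge0_integralD//; last 4 first.
- by move=> y _; rewrite mule_ge0.
- exact: measurable_funTS.
- by move=> y _; rewrite mule_ge0.
- exact: measurable_funTS.
rewrite ge0_integralZl//; last exact: measurable_funTS.
rewrite ge0_integralZl//; last exact: measurable_funTS.
have far_b : \int[mu]_(y in far_set A x) b y <= d%:E.
  apply: le_trans tail_b; apply: ge0_subset_integral => //.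
    exact: measurable_funTS.
  by move=> y [].
have far_a : \int[mu]_(y in far_set A x) a (x - y)%R <= d%:E.
  have tail_ax : \int[mu]_(y in (fun y => (x - y)%R) @^-1` (~` window A)) a (x - y)%R
      <= d%:E.
    by rewrite ge0_integral_reflect//; exact: measurable_funTS.
  apply: le_trans tail_ax; apply: ge0_subset_integral => //.
  - exact: measurable_preimage_reflect.
  - exact: measurable_funTS.
  - by move=> y [].
apply: (@le_trans _ _ (L%:E * (d%:E * m x + (m x * d%:E + m x * d%:E)))).
  apply: lee_wpmul2l; first by rewrite lee_fin ltW.
  by apply: leeD => //; apply: leeD; exact: lee_wpmul2l.
have -> : (e = 3 * L * d)%R by rewrite /d; field; rewrite gt_eqF.
rewrite ![m x * _]muleC.
case: (m x) (m0 x) => [r| |]// _.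
  by rewrite -!EFinM lee_fin; lra.
by rewrite [X in _ <= X]gt0_muley ?leey// lte_fin mulr_gt0// mulr_gt0.
Qed.

(** Unlike [conv_ge_sum] this needs a dominating subexponential function, to
    bound the part of the convolution that is not in the cores. *)
Lemma conv_le_sum (R : realType) (a b m : R -> \bar R) (C e : R) :
  subexponential m -> prob_density a -> long_tailed a ->
  prob_density b -> long_tailed b -> (0 < C)%R ->
  (\forall x \near +oo%R, a x <= C%:E * m x /\ b x <= C%:E * m x) ->
  almost_decreasing m \/
    (\forall x \near -oo%R, a x <= C%:E * m x /\ b x <= C%:E * m x) ->
  (0 < e)%R ->
  \forall x \near +oo%R,
    convolution a b x <= (1 + e)%:E * (a x + b x) + e%:E * m x.
Proof.
move=> mS aP aL bP bL C0 domR domL e0.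
have [ma a0 _] := aP; have [mb b0 _] := bP.
have [A A0 AP] := conv_core_ratio aL bP e0.
have [B B0 BP] := conv_core_ratio bL aP e0.
have [D D0 DP] := conv_rest_dominated mS aP bP C0 domR domL e0.
pose E := Num.max A (Num.max B D).
have [AE BE DE] : [/\ A <= E, B <= E & D <= E]%R.
  by rewrite /E !le_max !lexx !orbT.
have nearE : \forall x \near +oo%R, (2 * E < x)%R.
  by exists (2 * E)%R; split=> //; exact: num_real.
apply: filterS2 (filterI nearE (DP E DE)) (filterI (AP E AE) (BP E BE)) => x.
move=> [xE rest] [[u [r [ue re _ _ [h1 _]]]] [v [s [ve se _ _ [h2 _]]]]].
rewrite (@conv_split _ a b E x)//; apply: leeD => //.
by rewrite ue ve re se -!EFinD -EFinM lee_fin; lra.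
Qed.

Lemma near_pos_fin (R : realType) (a : R -> \bar R) :
  long_tailed a -> \forall x \near +oo%R, exists2 r : R, (0 < r)%R & a x = r%:E.
Proof.
move=> aL; apply: filterS (long_tailed_uniform aL ltr01 ltr01) => x xP.
have [|_ [r [_ ar _ r0 _]]] := xP 0%R; first by rewrite normr0.
by exists r.
Qed.

(** Given that s is long-tailed, only its order of magnitude matters at +oo; the
    last hypothesis controls the contribution of its left tail. *)
Lemma subexp_of_dominating (R : realType) (m s : R -> \bar R) (C C' : R) :
  subexponential m -> prob_density s -> long_tailed s ->
  (0 < C)%R -> (0 < C')%R ->
  (\forall x \near +oo%R, s x <= C%:E * m x) ->
  (\forall x \near +oo%R, m x <= C'%:E * s x) ->
  almost_decreasing m \/ (\forall x \near -oo%R, s x <= C%:E * m x) ->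
  subexponential s.
Proof.
move=> mS sP sL C0 C'0 sm ms domL; have [_ s0 _] := sP.
split => //; apply/asymp_equivP.
- by have [_ +] := convolution_density sP sP; exact.
- by move=> x; rewrite mule_ge0.
move=> e e0.
(* [conv_le_sum] with error d gives s * s <= 2 (1 + d) s + d C' s, and
   d (2 + C') = e. *)
pose d := (e / (2 + C'))%R.
have d0 : (0 < d)%R by rewrite divr_gt0//; lra.
have dE : (d * (2 + C') = e)%R by rewrite /d; field; rewrite gt_eqF//; lra.
have domR : \forall x \near +oo%R, s x <= C%:E * m x /\ s x <= C%:E * m x.
  by apply: filterS sm.
have domL' : almost_decreasing m \/
    (\forall x \near -oo%R, s x <= C%:E * m x /\ s x <= C%:E * m x).
  by case: domL => [|near_s]; [left|right; apply: filterS near_s].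
have up := conv_le_sum mS sP sL sP sL C0 domR domL' d0.
have low := conv_ge_sum sP sL sP sL e0.
apply: filterS2 (filterI up low) (filterI ms (near_pos_fin sL)) => x.
move=> [upx lowx] [msx [r r0 sx]].
apply: ratio_withinI => //.
- by have [_ +] := convolution_density sP sP; exact.
- by rewrite sx -EFinM lte_fin ltry mulr_gt0.
- apply: (le_trans upx); apply: (@le_trans _ _
    ((1 + d)%:E * (s x + s x) + d%:E * (C'%:E * s x))).
    by apply: leeD => //; apply: lee_wpmul2l => //; rewrite lee_fin ltW.
  rewrite sx -!EFinD -!EFinM lee_fin.
  have : (d * (2 + C') * r = e * r)%R by rewrite dE.
  have : (0 < e * r)%R by rewrite mulr_gt0.
  lra.
- by move: lowx; rewrite sx -!EFinD -!EFinM (_ : r + r = 2 * r)%R//; ring.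
Qed.

(** * Mixtures *)

Lemma convolutionC (R : realType) (a b : R -> \bar R) (x : R) :
  measurable_fun [set: R] a -> (forall z, 0 <= a z) ->
  measurable_fun [set: R] b -> (forall z, 0 <= b z) ->
  convolution a b x = convolution b a x.
Proof.
move=> ma a0 mb b0; rewrite /convolution -[RHS](@ge0_integral_reflect _ x)//.
- rewrite preimage_setT; apply: eq_integral => y _.
  by rewrite muleC; congr (b _ * _); ring.
- exact: measurable_conv_integrand.
- by move=> y; rewrite mule_ge0.
Qed.

Lemma convolution_linear_l (R : realType) (p q : R) (a b c : R -> \bar R) (x : R) :
  (0 <= p)%R -> (0 <= q)%R ->
  measurable_fun [set: R] a -> (forall z, 0 <= a z) ->
  measurable_fun [set: R] b -> (forall z, 0 <= b z) ->
  measurable_fun [set: R] c -> (forall z, 0 <= c z) ->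
  convolution (fun z => p%:E * a z + q%:E * b z) c x =
  p%:E * convolution a c x + q%:E * convolution b c x.
Proof.
move=> p0 q0 ma a0 mb b0 mc c0.
have mac := measurable_conv_integrand x ma mc.
have mbc := measurable_conv_integrand x mb mc.
rewrite /convolution -ge0_integralZl//; last by move=> y _; rewrite mule_ge0.
rewrite -ge0_integralZl//; last by move=> y _; rewrite mule_ge0.
rewrite -ge0_integralD//; first last.
- exact: measurable_funeM.
- by move=> y _; rewrite !mule_ge0.
- exact: measurable_funeM.
- by move=> y _; rewrite !mule_ge0.
apply: eq_integral => y _.
by rewrite ge0_muleDl ?mule_ge0 ?lee_fin// !muleA.
Qed.

Lemma convolution_mix (R : realType) (p q : R) (a b : R -> \bar R) (x : R) :
  (0 <= p)%R -> (0 <= q)%R ->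
  measurable_fun [set: R] a -> (forall z, 0 <= a z) ->
  measurable_fun [set: R] b -> (forall z, 0 <= b z) ->
  let m z := p%:E * a z + q%:E * b z in
  convolution m m x =
    p%:E * (p%:E * convolution a a x + q%:E * convolution a b x) +
    q%:E * (p%:E * convolution a b x + q%:E * convolution b b x).
Proof.
move=> p0 q0 ma a0 mb b0 m.
have m0 z : 0 <= m z by rewrite adde_ge0// mule_ge0// lee_fin.
have mm : measurable_fun [set: R] m.
  by apply: emeasurable_funD; apply: measurable_funeM.
rewrite convolution_linear_l// (convolutionC _ ma)// (convolutionC _ mb)//.
rewrite !convolution_linear_l//.
by rewrite (@convolutionC _ b a).
Qed.

(** With q = 1 - p, the lower bounds 2r (1 - d) <= ff and 2s (1 - d) <= gg
    leave for 2 p q fg at most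
    2 (1 + d) (p r + q s) - 2 (1 - d) (p^2 r + q^2 s), which exceeds
    2 p q (r + s) by at most 4 d (r + s) = 2 p q e (r + s). *)
Lemma mix_arith (R : realType) (p e d r s ff gg fg : R) :
  (0 < p < 1)%R -> (0 < e)%R -> d = (e * (p * (1 - p)) / 2)%R ->
  (0 <= r)%R -> (0 <= s)%R ->
  (r + r <= (1 + d) * ff)%R -> (s + s <= (1 + d) * gg)%R ->
  (p * (p * ff + (1 - p) * fg) + (1 - p) * (p * fg + (1 - p) * gg) <=
    (1 + d) * (2 * (p * r + (1 - p) * s)))%R ->
  (fg <= (1 + e) * (r + s))%R.
Proof.
move=> /andP[p0 p1] e0 dE r0 s0 hf hg hm.
have pq0 : (0 < p * (1 - p))%R by rewrite mulr_gt0//; lra.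
have d0 : (0 < d)%R by rewrite dE divr_gt0// mulr_gt0.
have low t w : (0 <= t)%R -> (t + t <= (1 + d) * w)%R -> (2 * t * (1 - d) <= w)%R.
  by move=> t0 tw; nra.
have p2f := ler_wpM2l (sqr_ge0 p) (low _ _ r0 hf).
have q2g := ler_wpM2l (sqr_ge0 (1 - p)%R) (low _ _ s0 hg).
have pr : (d * (p ^+ 2 * r + p * r) <= d * (r + r))%R.
  by rewrite ler_wpM2l ?(ltW d0)//; nra.
have qs : (d * ((1 - p) ^+ 2 * s + (1 - p) * s) <= d * (s + s))%R.
  by rewrite ler_wpM2l ?(ltW d0)//; nra.
rewrite -(ler_pM2l pq0).
have -> : (p * (1 - p) * ((1 + e) * (r + s)) =
    p * (1 - p) * (r + s) + 2 * d * (r + s))%R.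
  by rewrite dE; field.
lra.
Qed.

(** The mixture is finite and subexponential, so its convolution square is
    finite far out and equals p^2 f * f + 2 p q f * g + q^2 g * g; the excess of
    f * g over f + g would show up in it. *)
Lemma conv_asymp_of_mix (R : realType) (f g : R -> R) (p : R) :
  prob_density (EFin \o f) -> long_tailed (EFin \o f) ->
  prob_density (EFin \o g) -> long_tailed (EFin \o g) ->
  (0 < p < 1)%R ->
  subexponential (EFin \o (fun x => p * f x + (1 - p) * g x)%R) ->
  asymp_equiv (convolution (EFin \o f) (EFin \o g))
    (EFin \o (fun x => f x + g x)%R).
Proof.
move=> fP fL gP gL /andP[p0 p1] mS.
pose F := EFin \o f; pose G := EFin \o g.
have [mf f0 _] := fP; have [mg g0 _] := gP; have [mP _ mE] := mS.
pose q := (1 - p)%R; have q0 : (0 < q)%R by rewrite /q; lra.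
have pE : 0 < p%:E by rewrite lte_fin.
have qE : 0 < q%:E by rewrite lte_fin.
pose m z := p%:E * F z + q%:E * G z.
have conv_ge0 a b : prob_density a -> prob_density b ->
    forall x, 0 <= @convolution R a b x.
  by move=> aP bP; have [] := convolution_density aP bP.
have m0 z : 0 <= m z by rewrite adde_ge0// mule_ge0// lee_fin ltW.
have mEq : EFin \o (fun x => p * f x + (1 - p) * g x)%R = m.
  by apply/funext => z; rewrite /m /F /G/= -!EFinM -EFinD.
rewrite mEq in mP mE.
apply/asymp_equivP.
- exact: conv_ge0.
- by move=> x; apply: (@adde_ge0 _ (F x) (G x)); [exact: f0|exact: g0].
move=> e e0; pose d := (e * (p * q) / 2)%R.
have pq0 : (0 < p * q)%R by rewrite mulr_gt0.
have d0 : (0 < d)%R by rewrite divr_gt0// mulr_gt0.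
have m20 x : 0 <= 2%:E * m x by rewrite mule_ge0.
have up := (asymp_equivP (conv_ge0 _ _ mP mP) m20).1 mE d d0.
have lff := conv_ge_sum fP fL fP fL d0.
have lgg := conv_ge_sum gP gL gP gL d0.
have lfg := conv_ge_sum fP fL gP gL d0.
have lfg' := conv_ge_sum fP fL gP gL e0.
have posf := near_pos_fin fL.
apply: filterS3 (filterI lff lgg) (filterI lfg lfg') (filterI up posf) => x.
move=> [h1 h2] [h3 h4] [[u [v [+ + _ _ [h5 _]]]] [r r0 fr]].
rewrite convolution_mix ?(ltW p0) ?(ltW q0)// -/F -/G /m.
move: h1 h2 h3 h4; rewrite -/F -/G.
have ff0 := conv_ge0 F F fP fP x; have fg0 := conv_ge0 F G fP gP x.
have gg0 := conv_ge0 G G gP gP x.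
move: ff0 fg0 gg0.
case: (convolution F F x) => [ff| |]//; case: (convolution F G x) => [fg| |]//;
  case: (convolution G G x) => [gg| |]// _ _ _;
  (* An infinite convolution would make m * m infinite at x. *)
  move=> hf hg hfg hfg'; rewrite ?(gt0_muley pE, gt0_muley qE, addye, addey)//.
move=> [uE] [vE].
move: hf hg hfg'; rewrite /F /G/= -!EFinD -!EFinM !lee_fin => hf hg hfg'.
move: fr => /= -[fr].
have fx0 : (0 <= f x)%R by rewrite fr ltW.
have gx0 : (0 <= g x)%R by rewrite -lee_fin; exact: g0.
apply: ratio_withinI => //.
- rewrite lee_fin; nra.
- by rewrite ltry andbT lte_fin fr; lra.
- rewrite -EFinM lee_fin; apply: (@mix_arith _ p e d _ _ ff gg) => //.
    by rewrite p0 p1.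
  by move: h5; rewrite -uE -vE.
Qed.

(** * The two implications *)

Lemma half_sum_density (R : realType) (f g : R -> R) :
  prob_density (EFin \o f) -> prob_density (EFin \o g) ->
  prob_density (EFin \o (fun x => 2^-1 * (f x + g x))%R).
Proof.
move=> [mf f0 f1] [mg g0 g1].
have half_ge0 : (0 <= 2^-1 :> R)%R by rewrite invr_ge0.
have sE : EFin \o (fun x => 2^-1 * (f x + g x))%R =
    fun x => (2^-1)%:E * ((EFin \o f) x + (EFin \o g) x).
  by apply/funext => x /=; rewrite -EFinD -EFinM.
rewrite sE; split.
- by apply: measurable_funeM; exact: emeasurable_funD.
- move=> x; apply: mule_ge0; first by rewrite lee_fin.
  by apply: adde_ge0; [exact: f0|exact: g0].
rewrite ge0_integralZl//; first last.
- by move=> x _; exact: adde_ge0.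
- exact: emeasurable_funD.
rewrite ge0_integralD// f1 g1 -EFinD -EFinM; congr EFin.
by field.
Qed.

Lemma sum_long_tailed (R : realType) (f g : R -> R) (c : R) : (0 < c)%R ->
  (forall x, 0 <= f x)%R -> (forall x, 0 <= g x)%R ->
  long_tailed (EFin \o f) -> long_tailed (EFin \o g) ->
  long_tailed (EFin \o (fun x => c * (f x + g x))%R).
Proof.
move=> c0 f0 g0 fL gL; have [mf _ _] := fL; have [mg _ _] := gL.
have s0 x : (0 <= c * (f x + g x))%R by rewrite mulr_ge0 ?(ltW c0)// addr_ge0.
split.
- rewrite (_ : _ \o _ = fun x => c%:E * ((EFin \o f) x + (EFin \o g) x)).
    by apply: measurable_funeM; exact: emeasurable_funD.
  by apply/funext => x /=; rewrite -EFinD -EFinM.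
- by move=> x; rewrite lee_fin.
move=> y; pose S z := (c * (f z + g z))%:E.
rewrite -/(asymp_equiv (fun x => S (x - y)%R) S).
apply/asymp_equivP; [by move=> x; rewrite lee_fin..|move=> e e0].
have y1 : (`|y| <= `|y| + 1)%R by rewrite lerDl.
have Y0 : (0 < `|y| + 1)%R by rewrite ltr_wpDl.
apply: filterS2 (long_tailed_uniform fL Y0 e0) (long_tailed_uniform gL Y0 e0) => x.
move=> /(_ y y1) [r [s [[re] [se] r1 s1 [h1 h2]]]].
move=> /(_ y y1) [r' [s' [[re'] [se'] r1' s1' [h1' h2']]]].
rewrite /S re se re' se'; exists (c * (r + r'))%R, (c * (s + s'))%R.
split=> //; [by rewrite mulr_gt0// addr_gt0..|split].
  by rewrite mulrCA ler_pM2l//; lra.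
by rewrite mulrCA ler_pM2l//; lra.
Qed.

(** The remainder of f * g is controlled by e h, that is by f * g itself, and
    can be absorbed into the left-hand side. *)
Lemma conv_asymp_of_conv_subexp (R : realType) (f g : R -> R) (C : R) :
  prob_density (EFin \o f) -> long_tailed (EFin \o f) ->
  prob_density (EFin \o g) -> long_tailed (EFin \o g) ->
  let h := convolution (EFin \o f) (EFin \o g) in
  subexponential h -> (2 <= C)%R ->
  almost_decreasing h \/
    (\forall x \near -oo%R, (f x)%:E <= C%:E * h x /\ (g x)%:E <= C%:E * h x) ->
  asymp_equiv h (EFin \o (fun x => f x + g x)%R).
Proof.
move=> fP fL gP gL h hS C2 domL.
have [mf f0 _] := fP; have [mg g0 _] := gP; have [[_ h0 _] hL _] := hS.
have C0 : (0 < C)%R by lra.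
have fx0 x : (0 <= f x)%R by rewrite -lee_fin; exact: f0.
have gx0 x : (0 <= g x)%R by rewrite -lee_fin; exact: g0.
have domR : \forall x \near +oo%R, (f x)%:E <= C%:E * h x /\ (g x)%:E <= C%:E * h x.
  apply: filterS2 (conv_ge_sum fP fL gP gL ltr01) (near_pos_fin hL) => x + [u u0 hu].
  rewrite -/h hu/= -!EFinD -!EFinM !lee_fin => fg.
  have : (2 * u <= C * u)%R by rewrite ler_wpM2r// ltW.
  by move: (fx0 x) (gx0 x) => ? ? ?; split; lra.
apply/asymp_equivP => //.
  by move=> x; rewrite lee_fin addr_ge0.
move=> e e0; pose d := Num.min 2^-1%R (e / 4)%R.
have [d0 [d2 de]] : (0 < d)%R /\ (d <= 2^-1)%R /\ (d <= e / 4)%R.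
  by rewrite lt_min !ge_min !lexx orbT; split => //; apply/andP; split; lra.
have up := conv_le_sum hS fP fL gP gL C0 domR domL d0.
have low := conv_ge_sum fP fL gP gL e0.
apply: filterS3 up low (filterI (near_pos_fin hL) (near_pos_fin fL)) => x.
rewrite -/h => + + [[u u0 hu] [r r0 /= [fr]]]; rewrite hu -!EFinM !lee_fin.
move=> h1 h2; have := gx0 x => g0x.
rewrite fr in h1 h2 *; exists u, (r + g x)%R; split => //; first lra.
split=> //; set t := (r + g x)%R in h1 *.
have u3t : (u <= 3 * t)%R.
  have : (d * u <= 2^-1 * u)%R by rewrite ler_wpM2r// ltW.
  have : (d * t <= 2^-1 * t)%R by rewrite ler_wpM2r// /t; lra.
  by move: h1; lra.
have : (d * u <= d * (3 * t))%R by rewrite ler_wpM2l// ltW.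
have : (d * t <= e / 4 * t)%R by rewrite ler_wpM2r// /t; lra.
lra.
Qed.

Lemma sum_le_mix (R : realType) (p r s : R) : (0 < p < 1)%R ->
  (0 <= r)%R -> (0 <= s)%R ->
  (r + s <= (p^-1 + (1 - p)^-1) * (p * r + (1 - p) * s))%R.
Proof.
move=> /andP[p0 p1] r0 s0; have q0 : (0 < 1 - p)%R by lra.
have -> : ((p^-1 + (1 - p)^-1) * (p * r + (1 - p) * s) =
    r + s + ((1 - p) / p * s + p / (1 - p) * r))%R.
  by field; rewrite !gt_eqF.
by rewrite lerDl addr_ge0// mulr_ge0// divr_ge0 ?ltW.
Qed.

(** By [conv_asymp_of_mix], f * g has the order of the mixture at +oo; a bound
    on the upper limit makes it O(mix) at -oo as well. *)
Lemma conv_subexp_of_mix (R : realType) (f g : R -> R) (p : R) :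
  prob_density (EFin \o f) -> long_tailed (EFin \o f) ->
  prob_density (EFin \o g) -> long_tailed (EFin \o g) ->
  let fg := convolution (EFin \o f) (EFin \o g) in
  let sum_fg := EFin \o (fun x => f x + g x)%R in
  (0 < p < 1)%R ->
  let mix := EFin \o (fun x => p * f x + (1 - p) * g x)%R in
  subexponential mix ->
  almost_decreasing mix \/
    (exists C : R, (0 < C)%R /\ limsup_ratio_ninfty fg sum_fg <= C%:E) ->
  subexponential fg.
Proof.
move=> fP fL gP gL fg sum_fg p01 mix mixS left_cond.
have [mf f0E _] := fP; have [mg g0E _] := gP.
have f0 x : (0 <= f x)%R by rewrite -lee_fin; exact: f0E.
have g0 x : (0 <= g x)%R by rewrite -lee_fin; exact: g0E.
have fgP := convolution_density fP gP.
have [mfg fg0 _] := fgP.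
have sum0 x : 0 <= sum_fg x by rewrite lee_fin addr_ge0.
have sumL : long_tailed sum_fg.
  have := sum_long_tailed ltr01 f0 g0 fL gL.
  by congr long_tailed; apply/funext => x /=; rewrite mul1r.
have fgE : asymp_equiv fg sum_fg by exact: (conv_asymp_of_mix _ _ _ _ p01).
pose D := (p^-1 + (1 - p)^-1)%R.
have /andP[p0 p1] := p01.
have D0 : (0 < D)%R by rewrite addr_gt0// invr_gt0; lra.
have sum_mix x : sum_fg x <= D%:E * mix x.
  by rewrite -EFinM lee_fin; exact: sum_le_mix.
have mix_sum x : mix x <= sum_fg x.
  by rewrite lee_fin; have := f0 x; have := g0 x; nra.
have near_fg : \forall x \near +oo%R, ratio_within 1%R (fg x) (sum_fg x).
  exact: (asymp_equivP fg0 sum0).1 fgE 1%R ltr01.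
have [C [C2 left_fg]] : exists C : R, (2 <= C)%R /\ (almost_decreasing mix \/
    \forall x \near -oo%R, fg x <= C%:E * sum_fg x).
  case: left_cond => [|[C [C0 /(limsup_ratio_ninfty_le fg0 sum0 C0) Cle]]].
    by exists 2%R; split=> //; left.
  exists (C + 2)%R; split; first lra.
  right; apply: filterS Cle => x /le_trans; apply; apply: lee_wpmul2r => //.
  by rewrite lee_fin; lra.
have C0 : (0 < C)%R by lra.
apply: (@subexp_of_dominating _ mix fg (C * D)%R 2%R) => //.
+ exact: long_tailed_asymp sumL.
+ by rewrite mulr_gt0.
+ apply: filterS near_fg => x [u [v [-> sv u0 v0 [uv _]]]].
  rewrite EFinM -muleA (@le_trans _ _ (C%:E * sum_fg x))//.
    by rewrite sv -EFinM lee_fin; apply: (le_trans uv); rewrite ler_wpM2r ?(ltW v0).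
  by apply: lee_wpmul2l; [rewrite lee_fin ltW|exact: sum_mix].
+ apply: filterS near_fg => x [u [v [-> sv u0 v0 [_ vu]]]].
  by apply: (le_trans (mix_sum x)); rewrite sv -EFinM lee_fin.
+ case: left_fg => [|near_left]; [by left|right].
  apply: filterS near_left => x /le_trans; apply.
  rewrite EFinM -muleA; apply: lee_wpmul2l => //.
  by rewrite lee_fin (ltW C0).
Qed.

(** The half-sum has the order of f * g at +oo, and a positive lower limit
    makes it O(f * g) at -oo as well. *)
Lemma half_sum_subexp_of_conv (R : realType) (f g : R -> R) :
  prob_density (EFin \o f) -> long_tailed (EFin \o f) ->
  prob_density (EFin \o g) -> long_tailed (EFin \o g) ->
  let fg := convolution (EFin \o f) (EFin \o g) in
  let sum_fg := EFin \o (fun x => f x + g x)%R in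
  subexponential fg ->
  almost_decreasing fg \/
    (exists C : R, (0 < C)%R /\ C%:E <= liminf_ratio_ninfty fg sum_fg) ->
  asymp_equiv fg sum_fg /\
  subexponential (EFin \o (fun x => 2^-1 * (f x + g x))%R).
Proof.
move=> fP fL gP gL fg sum_fg fgS left_cond.
have [mf f0E _] := fP; have [mg g0E _] := gP.
have f0 x : (0 <= f x)%R by rewrite -lee_fin; exact: f0E.
have g0 x : (0 <= g x)%R by rewrite -lee_fin; exact: g0E.
have fgP := convolution_density fP gP.
have [mfg fg0 _] := fgP.
have sum0 x : 0 <= sum_fg x by rewrite lee_fin addr_ge0.
have [C [C2 left_sum]] : exists C : R, (2 <= C)%R /\ (almost_decreasing fg \/
    \forall x \near -oo%R, sum_fg x <= C%:E * fg x).
  case: left_cond => [|[C [C0 /(liminf_ratio_ninfty_ge fg0 sum0 C0) Cge]]].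
    by exists 2%R; split=> //; left.
  exists (2 + 2 / C)%R; split; first by rewrite lerDl divr_ge0// ltW.
  right; apply: filterS Cge => x Cx.
  have C20 : (0 <= (2 / C)%R%:E :> \bar R) by rewrite lee_fin divr_ge0// ltW.
  have := lee_wpmul2l C20 Cx; rewrite muleA -EFinM.
  rewrite (_ : 2 / C * (C / 2) = 1)%R ?mul1r; last first.
    by field; rewrite gt_eqF.
  move=> /le_trans; apply; apply: lee_wpmul2r; first exact: fg0.
  by rewrite lee_fin; lra.
have C0 : (0 < C)%R by lra.
have fgE : asymp_equiv fg sum_fg.
  apply: (conv_asymp_of_conv_subexp _ _ _ _ fgS C2) => //.
  case: left_sum => [|near_left]; [by left|right].
  apply: filterS near_left => x sx; split; apply: le_trans sx.
    by rewrite lee_fin lerDl.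
  by rewrite lee_fin lerDr.
split=> //.
pose s := EFin \o (fun x => 2^-1 * (f x + g x))%R.
have s_sum x : s x <= sum_fg x.
  by rewrite lee_fin; have := f0 x; have := g0 x; lra.
have near_fg : \forall x \near +oo%R, ratio_within 1%R (fg x) (sum_fg x).
  exact: (asymp_equivP fg0 sum0).1 fgE 1%R ltr01.
have half0 : (0 < 2^-1 :> R)%R by rewrite invr_gt0.
apply: (@subexp_of_dominating _ fg s C 4%R) => //.
+ exact: half_sum_density.
+ exact: sum_long_tailed.
+ apply: filterS near_fg => x [u [v [-> sv u0 v0 [_ vu]]]].
  apply: (le_trans (s_sum x)); rewrite sv -EFinM lee_fin.
  by apply: (le_trans vu); rewrite ler_wpM2r ?(ltW u0).
+ apply: filterS near_fg => x [u [v [-> [sv] u0 v0 [uv _]]]].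
  by rewrite -EFinM lee_fin sv; lra.
+ case: left_sum => [|near_left]; [by left|right].
  by apply: filterS near_left => x; exact: le_trans.
Qed.

Local Close Scope ereal_scope.
Local Close Scope classical_set_scope.

Theorem lemma2p4 (R : realType) (f g : R -> R)
  (f_density : prob_density (EFin \o f))
  (g_density : prob_density (EFin \o g))
  (f_long : long_tailed (EFin \o f))
  (g_long : long_tailed (EFin \o g)) :
  let fg := convolution (EFin \o f) (EFin \o g) in
  let sum_fg := EFin \o (fun x => f x + g x) in
  (forall p : R, 0 < p < 1 ->
     let mix := EFin \o (fun x => p * f x + (1 - p) * g x) in
     subexponential mix ->
     asymp_equiv fg sum_fg /\
     (almost_decreasing mix \/
      (exists C : R, 0 < C /\ (limsup_ratio_ninfty fg sum_fg <= C%:E)%E) ->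
      subexponential fg))
  /\
  (subexponential fg ->
   almost_decreasing fg \/
   (exists C : R, 0 < C /\ (C%:E <= liminf_ratio_ninfty fg sum_fg)%E) ->
   asymp_equiv fg sum_fg /\
   subexponential (EFin \o (fun x => 2^-1 * (f x + g x)))).
Proof.
move=> fg sum_fg; split=> [p p01 mix mixS|fgS left_cond].
  split; first exact: (conv_asymp_of_mix _ _ _ _ p01).
  exact: (conv_subexp_of_mix _ _ _ _ p01).
exact: half_sum_subexp_of_conv.
Qed.
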